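(* Let $p$ be an odd prime, $m,s$ positive integers, and $\mathcal{R}=\mathbb{F}_{p^m}[u,v]/\langle u^2,v^2,uv-vu\rangle$. Let $\alpha=\alpha_1+\alpha_2u+\alpha_3v+\alpha_4uv\in\mathcal{R}$ with $\alpha_1,\alpha_2,\alpha_3\in\mathbb{F}_{p^m}^*$, $\alpha_4\in\mathbb{F}_{p^m}$, and suppose $\alpha$ is not a square in $\mathcal{R}$. Let $\alpha_0\in\mathbb{F}_{p^m}$ be the element with $\alpha_0^{p^s}=\alpha_1$. Let $\mathcal{C}=\langle (x^2-\alpha_0)^\ell+u(x^2-\alpha_0)^tz(x)\rangle$ be the ideal of $\mathcal{R}_\alpha=\mathcal{R}[x]/\langle x^{2p^s}-\alpha\rangle$, where $0\le\ell\le 2p^s-1$, $0\le t<\ell$, and $z(x)$ is $0$ or a unit. Let $\Im$ be the smallest non-negative integer such that $u(x^2-\alpha_0)^{\Im}\in\mathcal{C}$. Then the symbol-pair distance of $\mathcal{C}$ is $$d_{sp}(\mathcal{C})=\begin{cases}2 & \text{if } 0\le\Im\le p^s;\\ 2(\Gamma+1)p^{\gamma} & \text{if } 2p^s-p^{s-\gamma}+(\Gamma-1)p^{s-\gamma-1}+1\le\Im\le 2p^s-p^{s-\gamma}+\Gamma p^{s-\gamma-1},\\ & \text{where } 1\le\Gamma\le p-1 \text{ and } 0\le\gamma\le s-1.\end{cases}$$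
   Context: Elements of $\mathcal{R}_\alpha=\mathcal{R}[x]/\langle x^{2p^s}-\alpha\rangle$ are identified with vectors in $\mathcal{R}^{2p^s}$: the class whose representative of degree less than $2p^s$ is $\zeta_0+\zeta_1x+\cdots+\zeta_{2p^s-1}x^{2p^s-1}$ corresponds to $(\zeta_0,\ldots,\zeta_{2p^s-1})$. Ideals of $\mathcal{R}_\alpha$ are thereby the $\alpha$-constacyclic codes of length $2p^s$ over $\mathcal{R}$. For vectors $x=(x_0,\ldots,x_{n-1})$, $y=(y_0,\ldots,y_{n-1})$ over an alphabet, the symbol-pair distance is $d_{sp}(x,y)=|\{i:0\le i\le n-1,\ (x_i,x_{i+1})\ne(y_i,y_{i+1})\}|$, indices taken modulo $n$; for a code $\mathcal{C}$ with at least two words, $d_{sp}(\mathcal{C})=\min\{d_{sp}(x,y):x,y\in\mathcal{C},x\ne y\}$. When $z(x)$ is a unit, it is represented as a finite sum $z(x)=\sum_{\kappa}(z_{0\kappa}x+z_{1\kappa})(x^2-\alpha_0)^\kappa$ with $z_{0\kappa},z_{1\kappa}\in\mathbb{F}_{p^m}$ and $z_{00}x+z_{10}\ne0$. *)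

(* Defs.v *)
From mathcomp Require Import all_boot all_order all_algebra.

Set Implicit Arguments.
Unset Strict Implicit.
Unset Printing Implicit Defensive.

Import GRing.Theory.
Local Open Scope ring_scope.

(* The ring F[u,v]/<u^2, v^2, uv - vu>, built as (F[u]/<u^2>)[v]/<v^2>.       *)
(* Lemmas baseR_proj_surj and baseR_proj_ker below identify it with the       *)
(* quotient of F[u][v] by the ideal generated by u^2 and v^2.                 *)
Definition dualR (F : fieldType) := {poly %/ ('X^2 : {poly F})}.

Definition baseR (F : fieldType) := {poly %/ ('X^2 : {poly (dualR F)})}.

Section BaseRing.
Variable F : fieldType.

Definition dualC (a : F) : dualR F := qpolyC ('X^2) a.
Definition baseC (a : F) : baseR F := qpolyC ('X^2) (dualC a).
Definition bu : baseR F := qpolyC ('X^2) ('qX : dualR F).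
Definition bv : baseR F := 'qX.

Definition baseR_proj (P : {poly {poly F}}) : baseR F :=
  in_qpoly ('X^2) (map_poly (in_qpoly ('X^2) : {poly F} -> dualR F) P).

End BaseRing.

Section Quotient.
Variables (R : comNzRingType) (n : nat) (a : R).

(* R[x]/<x^n - a>; for n > 0 the modulus is monic of positive degree, so      *)
(* {poly %/ _} is the genuine quotient (lemma mk_monic_ccmod).                *)
Definition ccmod : {poly R} := 'X^n - a%:P.
Definition ccring := {poly %/ ccmod}.

Definition ccC (r : R) : ccring := qpolyC ccmod r.

Definition ccX : ccring := 'qX.

(* Elements of {poly %/ _} are their reduced representatives, so this is the  *)
(* vector of coefficients of the representative of degree less than n.        *)
Definition ccvec (c : ccring) : 'rV[R]_n := \row_(i < n) (c : {poly R})`_i.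

Lemma mk_monic_ccmod : (0 < n)%N -> mk_monic ccmod = ccmod.
Proof.
move=> n_gt0; rewrite /mk_monic /ccmod size_XnsubC // ltnS n_gt0.
by rewrite monicXnsubC.
Qed.

End Quotient.

Definition in_principal (S : comNzRingType) (g c : S) : Prop :=
  exists b : S, c = b * g.

Definition invertible (S : comNzRingType) (z : S) : Prop :=
  exists y : S, z * y = 1.

Definition is_square (S : comNzRingType) (a : S) : Prop :=
  exists b : S, a = b ^+ 2.

Definition code_of (R : comNzRingType) (n : nat) (a : R)
  (I : ccring n a -> Prop) : 'rV[R]_n -> Prop :=
  fun x => exists2 c, I c & x = ccvec c.

(* ordS i is i + 1 modulo n.                                                  *)
Definition d_sp (A : eqType) (n : nat) (x y : 'rV[A]_n) : nat :=
  #|[set i : 'I_n | (x ord0 i, x ord0 (ordS i)) != (y ord0 i, y ord0 (ordS i))]|.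

(* d is the minimum of d_sp x y over distinct codewords x, y.                 *)
Definition is_sp_distance (A : eqType) (n : nat) (C : 'rV[A]_n -> Prop)
    (d : nat) : Prop :=
  (exists x y, [/\ C x, C y, x <> y & d_sp x y = d]) /\
  (forall x y, C x -> C y -> x <> y -> (d <= d_sp x y)%N).

Definition is_least (P : nat -> Prop) (n : nat) : Prop :=
  P n /\ forall k, P k -> (n <= k)%N.

Section Generator.
Variables (F : fieldType) (n : nat) (a : baseR F).

Definition ccF (b : F) : ccring n a := ccC n a (baseC b).
Definition ccu : ccring n a := ccC n a (bu F).
Definition ccw (a0 : F) : ccring n a := ccX n a ^+ 2 - ccF a0.

Definition zero_or_unit_form (a0 : F) (z : ccring n a) : Prop :=
  z = 0 \/
  (invertible z /\
   exists k (z0 z1 : 'I_k.+1 -> F),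
     z = \sum_(i < k.+1) (ccF (z0 i) * ccX n a + ccF (z1 i)) * ccw a0 ^+ i /\
     ccF (z0 ord0) * ccX n a + ccF (z1 ord0) <> 0).

End Generator.

Section BaseRingPresentation.

Lemma in_qpoly_X2 (R : nzRingType) (P : {poly R}) :
  in_qpoly 'X^2 P = take_poly 2 P :> {poly R}.
Proof.
rewrite /= (mk_monic_Xn R 2) -{1}(poly_take_drop 2 P) addrC.
by rewrite Pdiv.RingMonic.rmodp_addl_mul_small ?monicXn ?size_polyXn ?ltnS
  ?size_take_poly.
Qed.

Lemma in_qpoly_X2_eq0 (R : nzRingType) (P : {poly R}) :
  in_qpoly 'X^2 P = 0 <-> take_poly 2 P = 0.
Proof.
by rewrite -in_qpoly_X2; split=> [->//|P0]; apply: val_inj.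
Qed.

Variable F : fieldType.

Lemma baseR_projD (P Q : {poly {poly F}}) :
  baseR_proj (P + Q) = baseR_proj P + baseR_proj Q.
Proof. by rewrite /baseR_proj !rmorphD. Qed.

Lemma baseR_projM (P Q : {poly {poly F}}) :
  baseR_proj (P * Q) = baseR_proj P * baseR_proj Q.
Proof. by rewrite /baseR_proj !rmorphM. Qed.

Lemma in_qpolyC_X2 (R : nzRingType) (b : R) :
  in_qpoly 'X^2 b%:P = qpolyC 'X^2 b.
Proof.
apply: val_inj; rewrite [LHS]in_qpoly_X2 /= take_poly_id //.
by rewrite (leq_trans (size_polyC_leq1 _)).
Qed.

Lemma baseR_projC (b : F) : baseR_proj b%:P%:P = baseC b.
Proof. by rewrite /baseR_proj map_polyC /= !in_qpolyC_X2. Qed.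

Lemma baseR_proj_u : baseR_proj 'X%:P = bu F.
Proof. by rewrite /baseR_proj map_polyC /= in_qpolyC_X2. Qed.

Lemma baseR_proj_v : baseR_proj 'X = bv F.
Proof. by rewrite /baseR_proj map_polyX. Qed.

Lemma baseR_proj_surj (r : baseR F) : exists P, baseR_proj P = r.
Proof.
exists (map_poly (fun d : dualR F => d : {poly F}) (r : {poly _})).
apply: val_inj.
rewrite [LHS]in_qpoly_small; last first.
  apply: leq_ltn_trans (size_mk_monic r).
  by rewrite (leq_trans (size_poly _ _)) ?size_poly.
apply/polyP=> i; rewrite coef_map coef_map_id0 //.
by apply: val_inj; rewrite [LHS]in_qpoly_small ?size_mk_monic.
Qed.

Lemma baseR_proj_ker (P : {poly {poly F}}) :
  baseR_proj P = 0 <-> exists A B, P = A * ('X^2)%:P + B * 'X^2.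
Proof.
split=> [P0|[A [B ->]]].
  exists (map_poly (drop_poly 2) (take_poly 2 P)), (drop_poly 2 P).
  rewrite -[LHS](poly_take_drop 2); congr (_ + _).
  apply/polyP=> i; rewrite coefMC coef_map_id0; last exact: drop_poly0r.
  rewrite -[LHS](poly_take_drop 2) -[RHS]add0r; congr (_ + _).
  rewrite coef_take_poly; case: ltnP => [i_lt2|_]; last exact: take_poly0r.
  apply/in_qpoly_X2_eq0.
  have /in_qpoly_X2_eq0/polyP/(_ i) := P0.
  by rewrite coef_take_poly i_lt2 coef_map coef0.
have X20 (R : nzRingType) : in_qpoly 'X^2 ('X^2 : {poly R}) = 0.
  apply/in_qpoly_X2_eq0/polyP=> i; rewrite coef_take_poly coef0 coefXn.
  by case: i => [|[|i]].
have u2_0 : baseR_proj (('X^2)%:P : {poly {poly F}}) = 0.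
  by rewrite /baseR_proj map_polyC /= X20 linear0.
have v2_0 : baseR_proj 'X * baseR_proj 'X = 0 :> baseR F.
  by rewrite baseR_proj_v -in_qpolyM -expr2 X20.
by rewrite baseR_projD !baseR_projM u2_0 v2_0 !mulr0 addr0.
Qed.

End BaseRingPresentation.

(* Main.v *)
(* The ideal C only matters through J.  Any nonzero vector over
   R = F[u,v]/<u^2,v^2> has an R-multiple that is a nonzero vector over uvF, so
   the minimum pair weight of C is attained on its part uv f with f in F[x].
   In R[x]/<x^n - alpha>, with w = x^2 - a0, one has u w^(p^s) = a3 uv and
   uv w^(p^s) = 0; as x^2 - a0 is irreducible (alpha, hence a0, is not a
   square), uv f lies in C exactly when (x^2 - a0)^(J - p^s) divides f.
   Splitting f into even and odd parts, the minimum pair weight is twice the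
   minimum Hamming weight of the repeated-root code generated by
   (y - a0)^(J - p^s) in length p^s, which is computed by induction on s. *)

Require Import Defs.
From HB Require Import structures.
From mathcomp Require Import all_boot all_order all_algebra.
From mathcomp Require Import finfield zify ring.

Set Implicit Arguments.
Unset Strict Implicit.
Unset Printing Implicit Defensive.

Import GRing.Theory.
Local Open Scope ring_scope.

(** * Hamming weights of repeated-root codes *)

Lemma exprB_pchar (R : comNzRingType) p (x y : R) e :
  p \in [pchar R] -> (x - y) ^+ (p ^ e) = x ^+ (p ^ e) - y ^+ (p ^ e).
Proof.
move=> pcharR; elim: e => [|e IHe]; first by rewrite !expr1.
rewrite expnSr !exprM IHe -!(pFrobenius_autE pcharR).
exact: pFrobenius_autB_comm (mulrC _ _).
Qed.

(** Recursion behind both weight bounds: with q = p^(g+e+1), the factor (X - a)^(q(p-1)) splits off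
    and the case of g remains. *)
Lemma rep_root_exponentS p g e i : (0 < p)%N ->
  (p ^ (g.+1 + e).+1 - p ^ e.+1 + i)%N =
  (p ^ (g + e).+1 * p.-1 + (p ^ (g + e).+1 - p ^ e.+1 + i))%N.
Proof.
move=> p_gt0.
have : (p ^ e.+1 <= p ^ (g + e).+1)%N by rewrite leq_pexp2l // ltnS leq_addl.
have -> : (p ^ (g.+1 + e).+1 = p ^ (g + e).+1 * p.-1 + p ^ (g + e).+1)%N.
  by rewrite -mulnSr prednK // addSn expnSr.
by move=> le_q; rewrite -addnBA // addnA.
Qed.

(* Base-p digits: g is the number of leading digits of i equal to p - 1. *)
Lemma rep_root_band p s i : (0 < p)%N -> (0 < i < p ^ s)%N ->
  exists g e k, [/\ s = (g + e).+1, (k.+1 < p)%N &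
    (p ^ s - p ^ e.+1 + k * p ^ e < i <= p ^ s - p ^ e.+1 + k.+1 * p ^ e)%N].
Proof.
move=> p_gt0; elim: s i => [|s IHs] i; first by case: i => [|[]].
move=> /andP[i_gt0 lt_i]; have q_gt0 : (0 < p ^ s)%N by rewrite expn_gt0 p_gt0.
have pS : (p ^ s.+1 = p ^ s * p.-1 + p ^ s)%N by rewrite -mulnSr prednK // expnSr.
have [le_i | lt_q] := leqP i (p ^ s * p.-1).
  (* Bands are open on the left and closed on the right, hence the division of i - 1 rather than
     i. *)
  exists 0, s, (i.-1 %/ p ^ s)%N; rewrite subnn add0n; split=> //.
    suff : (i.-1 %/ p ^ s < p.-1)%N by lia.
    by rewrite ltn_divLR // mulnC prednK.
  have := leq_divM i.-1 (p ^ s); have := ltn_ceil i.-1 q_gt0; lia.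
(* Here the top digit of i - 1 is p - 1: it is removed and counted in g. *)
have [|g [e [k [def_s lt_k le_i]]]] := IHs (i - p ^ s * p.-1)%N; first by lia.
exists g.+1, e, k; split=> //; first by rewrite def_s.
have : (p ^ e.+1 <= p ^ s)%N by rewrite leq_pexp2l // def_s ltnS leq_addl.
by rewrite pS; lia.
Qed.

(** * Supports and weights of polynomials *)

Section Weight.
Variable F : fieldType.
Implicit Types (f h : {poly F}) (a b : F).

Definition supp (N : nat) f : {set 'I_N} := [set i : 'I_N | f`_i != 0].
Definition wt (N : nat) f : nat := #|supp N f|.

Lemma supp_neq0 N f : f != 0 -> (size f <= N)%N -> exists i, i \in supp N f.
Proof.
move=> f0 sf; have lt_dN : ((size f).-1 < N)%N.
  by rewrite prednK // size_poly_gt0.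
by exists (Ordinal lt_dN); rewrite inE /= -lead_coefE lead_coef_eq0.
Qed.

Lemma wt_gt0 N f : f != 0 -> (size f <= N)%N -> (0 < wt N f)%N.
Proof. by move=> f0 sf; apply/card_gt0P/supp_neq0. Qed.

(** The support of a product lies in the sumset of the supports. Sums out of range, sent by [inord]
    to a default value, are harmless: only inclusion in the image is needed. *)
Lemma wtM N f g : (wt N (f * g) <= wt N f * wt N g)%N.
Proof.
case: N => [|N]; first by rewrite /wt (eq_card0 (A := supp 0 _)) // => -[].
rewrite -cardsX.
set add := fun ij : 'I_N.+1 * 'I_N.+1 => inord (ij.1 + ij.2) : 'I_N.+1.
apply: leq_trans (leq_imset_card add _); apply/subset_leq_card/subsetP=> m.
rewrite inE coefM => fg_m.
have /existsP[i] : [exists i : 'I_m.+1, f`_i * g`_(m - i) != 0].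
  apply: contraNT fg_m; rewrite negb_exists => /forallP zero.
  by rewrite big1 // => i _; apply/eqP; have := zero i; rewrite negbK.
rewrite mulf_eq0 negb_or => /andP[fi gi].
have [ltm lti] := (ltn_ord m, ltn_ord i).
apply/imsetP; exists (inord i, inord (m - i)).
  by rewrite !inE !inordK ?fi ?gi //; lia.
by apply: val_inj; rewrite /= !inordK ?subnKC //; lia.
Qed.

Lemma wt_comp_Xn N q f k : (0 < q)%N -> (size f <= k)%N ->
  (wt N (f \Po 'X^q) <= k)%N.
Proof.
move=> q_gt0 sf; case: N => [|N].
  by rewrite /wt (eq_card0 (A := supp 0 _)) // => -[].
rewrite -[leqRHS]card_ord; pose mul (j : 'I_k) : 'I_N.+1 := inord (j * q).
apply: leq_trans (leq_imset_card mul _); apply/subset_leq_card/subsetP=> m.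
rewrite inE coef_comp_poly_Xn //; case: ifP => [q_m | _]; last by rewrite eqxx.
move=> fm; have lt_m : (m %/ q < k)%N.
  rewrite ltnNge; apply: contra fm => le_k.
  by rewrite nth_default ?(leq_trans sf).
apply/imsetP; exists (Ordinal lt_m) => //.
by apply: val_inj; rewrite /mul /= divnK // inordK.
Qed.

(** As h fits in one block of length q, its shifts by multiples of q do not overlap, and a single
    term of the convolution survives. *)
Lemma coef_comp_Xn_mul q f h k r : (r < q)%N -> (size h <= q)%N ->
  ((f \Po 'X^q) * h)`_(k * q + r) = f`_k * h`_r.
Proof.
move=> lt_rq sh; have q_gt0 : (0 < q)%N by lia.
rewrite coefM (bigD1 (inord (k * q))) //= inordK ?ltnS ?leq_addr //.
rewrite coef_comp_poly_Xn // dvdn_mull // mulnK // addKn.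
rewrite big1 ?addr0 // => i neq_i; rewrite coef_comp_poly_Xn //.
case: ifP => [/dvdnP[j eq_i] | _]; last by rewrite mul0r.
have lt_i := ltn_ord i.
suff -> : h`_(k * q + r - i) = 0 by rewrite mulr0.
rewrite nth_default // (leq_trans sh) // eq_i.
have lt_jk : (j < k)%N.
  have neq_jk : j != k.
    apply: contraNneq neq_i => eq_jk; apply/eqP/val_inj.
    by rewrite /= inordK ?eq_i ?eq_jk // ltnS leq_addr.
  have : (j * q < k.+1 * q)%N by lia.
  by rewrite ltn_pmul2r //; lia.
have : (j.+1 * q <= k * q)%N by rewrite leq_pmul2r.
rewrite mulSn; lia.
Qed.

(** Each of the first m blocks of length q holds a nonzero scalar multiple of h. *)
Lemma wt_comp_Xn_mul m q f h : (size h <= q)%N ->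
  (forall k, (k < m)%N -> f`_k != 0) ->
  (m * wt q h <= wt (m * q) ((f \Po 'X^q) * h))%N.
Proof.
move=> sh f_neq0; case: q sh => [|q] sh.
  by rewrite {1}/wt (eq_card0 (A := supp 0 h)) ?muln0 // => -[].
have lt_kr (kr : 'I_m * 'I_q.+1) : (kr.1 * q.+1 + kr.2 < m * q.+1)%N.
  have := leq_mul2r q.+1 kr.1.+1 m; rewrite ltn_ord orbT mulSn => le_k.
  by have := ltn_ord kr.2; lia.
pose enc kr := Ordinal (lt_kr kr).
have enc_inj : injective enc.
  move=> [k r] [k' r'] /(congr1 val) /= eq_enc.
  have eq_k : k = k' :> nat.
    have := congr1 (divn^~ q.+1) eq_enc.
    by rewrite /= !divnMDl // !divn_small ?addn0.
  have eq_r : r = r' :> nat by move: eq_enc; rewrite eq_k => /addnI.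
  by congr (_, _); apply: val_inj.
have -> : (m * wt q.+1 h = #|setX [set: 'I_m] (supp q.+1 h)|)%N.
  by rewrite cardsX cardsT card_ord.
rewrite -(card_imset _ enc_inj); apply/subset_leq_card/subsetP.
move=> _ /imsetP[[k r] hr ->]; move: hr; rewrite !inE /= => hr.
by rewrite coef_comp_Xn_mul // mulf_neq0 ?f_neq0.
Qed.

(** A single monomial cannot vanish at a nonzero point. *)
Lemma wt_ge2 N f a : a != 0 -> f != 0 -> (size f <= N)%N -> f.[a] = 0 ->
  (2 <= wt N f)%N.
Proof.
move=> a0 f0 sf fa; have [i fi] := supp_neq0 f0 sf.
rewrite ltnNge; apply/negP=> /card_le1_eqP eq_i.
have := fi; rewrite inE => /negP[].
have : f.[a] = f`_i * a ^+ i.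
  rewrite (horner_coef_wide _ sf) (bigD1 i) //= big1 ?addr0 // => j neq_j.
  suff /eqP-> : f`_j == 0 by rewrite mul0r.
  by apply: contraNT neq_j => fj; apply/eqP/eq_i; rewrite // inE.
move/esym/eqP; rewrite fa mulf_eq0 expf_eq0 (negPf a0) andbF orbF.
by move=> /eqP->.
Qed.

(* Up to a factor X^q this is the q-th Hasse derivative, f |-> X^q f^[q];
   like a derivation, it lowers the multiplicity of a factor X^q - b by one,
   while blockD q - k kills the terms of f with exponent in [kq, (k+1)q[. *)
Definition blockD q f : {poly F} := \poly_(i < size f) ((i %/ q)%:R * f`_i).

Lemma coef_blockD q f i : (blockD q f)`_i = (i %/ q)%:R * f`_i.
Proof.
by rewrite coef_poly; case: ltnP => // le_i; rewrite [f`_i]nth_default ?mulr0.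
Qed.

Lemma size_blockD q f : (size (blockD q f) <= size f)%N.
Proof. exact: size_poly. Qed.

Lemma blockD_XnsubC q b g : (0 < q)%N ->
  blockD q (('X^q - b%:P) * g) = ('X^q - b%:P) * blockD q g + 'X^q * g.
Proof.
move=> q_gt0; apply/polyP=> i.
rewrite coef_blockD coefD !mulrBl !coefB !coefXnM !coefCM !coef_blockD.
case: ltnP => [lt_iq | le_qi]; first by rewrite divn_small //; ring.
have -> : (i %/ q = (i - q) %/ q + 1)%N.
  by rewrite -{1}(subnK le_qi) divnDr // divnn q_gt0.
by rewrite natrD; ring.
Qed.

Lemma blockD_exp q b g k : (0 < q)%N ->
  blockD q (('X^q - b%:P) ^+ k.+1 * g) =
  ('X^q - b%:P) ^+ k *
    (('X^q - b%:P) * blockD q g + 'X^q * g *+ k.+1).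
Proof.
move=> q_gt0; elim: k => [|k IHk]; first by rewrite expr0 mul1r blockD_XnsubC.
rewrite exprS -mulrA blockD_XnsubC // IHk.
move: (blockD q g) ('X^q - _) => D B; rewrite !exprS [in RHS]mulrS; ring.
Qed.

(** * Weights of multiples of powers of X - a in characteristic p *)

Section RepeatedRoot.
Variable p : nat.
Hypotheses (p_prime : prime p) (pcharF : p \in [pchar F]).

Lemma exp_XsubC a e : ('X - a%:P) ^+ (p ^ e) = 'X^(p ^ e) - (a ^+ (p ^ e))%:P.
Proof. by rewrite polyC_exp exprB_pchar // pchar_poly. Qed.

Lemma natr_inj_ltn i j : (i < p)%N -> (j < p)%N -> i%:R = j%:R :> F -> i = j.
Proof.
wlog le_ij : i j / (i <= j)%N.
  by move=> H; case/orP: (leq_total i j) => ? *; [|symmetry]; apply: H.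
move=> lt_i lt_j /eqP; rewrite eq_sym -subr_eq0 -natrB // -(dvdn_pcharf pcharF).
move=> dvd_p; apply/eqP; rewrite eqn_leq le_ij /= -subn_eq0.
by apply: contraTT dvd_p => sub_n0; rewrite gtnNdvd ?lt0n //; lia.
Qed.

(** Induction on k with q = p^e: if c is the block of a nonzero term, [blockD q f] - c f has fewer
    terms than f, while the guaranteed multiplicity of the root a drops by q only. *)
Lemma blockD_wt_ge k e N f a : a != 0 -> (k.+1 < p)%N -> f != 0 ->
    (size f <= N)%N -> (N <= p * p ^ e)%N ->
    ('X - a%:P) ^+ (k * p ^ e).+1 %| f ->
  (k.+2 <= wt N f)%N.
Proof.
move=> a0; elim: k f => [|k IHk] f lt_kp f0 sf leN.
  by rewrite mul0n expr1 dvdp_XsubCl => /rootP; apply: wt_ge2.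
set q := (p ^ e)%N in leN IHk *.
have q_gt0 : (0 < q)%N by rewrite expn_gt0 prime_gt0.
move=> dvd_f; have [i fi] := supp_neq0 f0 sf; set c := (i %/ q)%N.
have lt_div (j : 'I_N) : (j %/ q < p)%N.
  by rewrite ltn_divLR // (leq_trans (ltn_ord j)).
pose h := blockD q f - c%:R *: f.
have coef_h j : h`_j = ((j %/ q)%:R - c%:R) * f`_j.
  by rewrite coefB coefZ coef_blockD mulrBl.
have sub_h : supp N h \proper supp N f.
  apply/properP; split.
    by apply/subsetP=> j; rewrite !inE coef_h mulf_eq0 negb_or => /andP[].
  by exists i => //; rewrite inE coef_h subrr mul0r eqxx.
suff [h0 dvd_h] : h != 0 /\ ('X - a%:P) ^+ (k * q).+1 %| h.
  apply: leq_ltn_trans (proper_card sub_h); apply: IHk => //.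
    exact: ltnW.
  rewrite (leq_trans (size_polyD _ _)) // geq_max size_polyN.
  by rewrite (leq_trans (size_scale_leq _ _)) ?(leq_trans (size_blockD _ _)).
split.
  (* If h = 0, then f lives in the single block c, as block indices below p stay distinct in F. So f
     = X^(cq) f' with f' of degree below q, too small for a root of multiplicity above q. *)
  apply: contraTneq dvd_f => h0; pose f' := \poly_(r < q) f`_(c * q + r).
  have f_block j : (j %/ q != c)%N -> f`_j = 0.
    have [lt_jN | le_Nj] := ltnP j N; last by rewrite nth_default ?(leq_trans sf).
    apply: contraNeq => fj; have /eqP : h`_j = 0 by rewrite h0 coef0.
    rewrite coef_h mulf_eq0 (negPf fj) orbF subr_eq0 => /eqP eq_c.
    apply/eqP; apply: natr_inj_ltn eq_c; last exact: lt_div.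
    exact: (lt_div (Ordinal lt_jN)).
  have def_f : f = f' * 'X^(c * q).
    apply/polyP=> j; rewrite coefMXn coef_poly.
    case: ltnP => [lt_j | le_j].
      by rewrite f_block // neq_ltn ltn_divLR // lt_j.
    case: ltnP => [_ | le_qj]; first by rewrite subnKC.
    rewrite f_block // neq_ltn leq_divRL // mulSn; apply/orP; right; lia.
  rewrite def_f Gauss_dvdpl; last first.
    apply/coprimep_expl/coprimep_expr.
    by rewrite coprimep_sym coprimep_XsubC rootX.
  apply/negP=> /dvdp_leq; rewrite size_exp_XsubC => size_f'.
  have f'0 : f' != 0 by apply: contraNneq f0 => f'0; rewrite def_f f'0 mul0r.
  have := leq_trans (size_f' f'0) (size_poly _ _).
  by rewrite mulSn; lia.
(* With B = X^q - a^q, f = B^(k+1) (X - a) g. The operator costs one factor B, and X - a survives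
   because it divides the B in front of D. *)
have XqE : 'X^q - (a ^+ q)%:P = ('X - a%:P) ^+ q.-1 * ('X - a%:P).
  by rewrite -exprSr prednK // exp_XsubC.
move: dvd_f; rewrite [X in X %| _]exprSr mulnC exprM exp_XsubC -/q => /dvdpP[g].
rewrite mulrC -mulrA => def_f; rewrite exprSr mulnC exprM exp_XsubC -/q.
rewrite /h def_f blockD_exp //; move: (blockD _ _) => D.
apply/dvdpP; exists (('X - a%:P) ^+ q.-1 * D + 'X^q * g *+ k.+1
                     - c%:R *: (('X^q - (a ^+ q)%:P) * g)).
rewrite -!mul_polyC [_ ^+ k.+1]exprSr.
have ring_id (A B Y Z f1 f2 d : {poly F}) : B = A * Z ->
    B ^+ k * (B * f2 + Y * (Z * f1) *+ k.+1) - d * (B ^+ k * B * (Z * f1)) =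
    (A * f2 + Y * f1 *+ k.+1 - d * (B * f1)) * (B ^+ k * Z).
  by move=> ->; ring.
exact: ring_id XqE.
Qed.

(** Cancelling X - a in X^p - a^p leaves the sum of the X^(p-1-i) a^i, whose coefficients are powers
    of a. *)
Lemma coef_exp_pred_neq0 a k : a != 0 -> (k < p)%N ->
  (('X - a%:P) ^+ p.-1)`_k != 0.
Proof.
move=> a0 lt_kp; have p_gt0 := prime_gt0 p_prime.
have -> : ('X - a%:P) ^+ p.-1 = \sum_(i < p) 'X^(p.-1 - i) * a%:P ^+ i.
  apply: (mulfI (x := 'X - a%:P)); first by rewrite polyXsubC_eq0.
  by rewrite -exprS prednK // -subrXX -(expn1 p) exp_XsubC polyC_exp.
rewrite coef_sum (bigD1 (Ordinal (rev_ord_proof (Ordinal lt_kp)))) //=.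
rewrite big1 ?addr0; last first.
  move=> i neq_i; rewrite -polyC_exp coefMC coefXn.
  case: eqP => [eq_k | _]; last by rewrite mul0r.
  by case/eqP: neq_i; apply: val_inj => /=; have := ltn_ord i; lia.
rewrite -polyC_exp coefMC coefXn mulf_neq0 ?expf_neq0 //.
by rewrite (_ : (k == _) = true) ?oner_eq0 //; lia.
Qed.

Lemma exp_XsubC_comp a k e :
  ('X - a%:P) ^+ (p ^ e * k) = ('X - (a ^+ (p ^ e))%:P) ^+ k \Po 'X^(p ^ e).
Proof.
by rewrite exprM exp_XsubC [RHS]rmorphXn /= comp_polyB comp_polyX comp_polyC.
Qed.

(** Induction on g: with q = p^(g+e+1), f = (X^q - a^q)^(p-1) h where h fits in one block. The first
    factor has p nonzero coefficients in X^q, so f weighs at least p times h. The base case is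
    [blockD_wt_ge]. *)
Lemma rep_root_wt_ge g e k f a : a != 0 -> (k.+1 < p)%N -> f != 0 ->
    (size f <= p ^ (g + e).+1)%N ->
    ('X - a%:P) ^+ (p ^ (g + e).+1 - p ^ e.+1 + (k * p ^ e).+1) %| f ->
  (k.+2 * p ^ g <= wt (p ^ (g + e).+1) f)%N.
Proof.
move=> a0 lt_kp; elim: g f => [|g IHg] f f0 sf.
  rewrite add0n subnn add0n expn0 muln1; apply: blockD_wt_ge => //.
  by rewrite expnS.
have p_gt0 := prime_gt0 p_prime.
rewrite rep_root_exponentS ?prime_gt0 // exprD => /dvdpP[f']; rewrite mulrCA.
set h := f' * _ => def_f.
have h0 : h != 0 by apply: contraNneq f0 => h0; rewrite def_f h0 mulr0.
have sh : (size h <= p ^ (g + e).+1)%N.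
  move: sf; rewrite def_f size_monicM ?monic_exp ?monicXsubC // size_exp_XsubC.
  have -> : (p ^ (g.+1 + e).+1 = p ^ (g + e).+1 * p.-1 + p ^ (g + e).+1)%N.
    by rewrite -mulnSr prednK // addSn expnSr.
  by rewrite addSn leq_add2l.
rewrite addSn [(p ^ (g + e).+2)%N]expnS expnS mulnCA def_f exp_XsubC_comp.
apply: leq_trans (wt_comp_Xn_mul sh _).
  by rewrite leq_pmul2l // IHg // dvdp_mull.
by move=> i lt_ip; rewrite coef_exp_pred_neq0 // expf_neq0.
Qed.

(** The same factorization, now with submultiplicativity of the weight: each step on g contributes
    at most p terms, and (X^q - a^q)^k at most k + 1. *)
Lemma rep_root_wt_le N g e k a :
  (wt N (('X - a%:P) ^+ (p ^ (g + e).+1 - p ^ e.+1 + k * p ^ e))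
   <= k.+1 * p ^ g)%N.
Proof.
have q_gt0 i : (0 < p ^ i)%N by rewrite expn_gt0 prime_gt0.
elim: g => [|g IHg].
  rewrite add0n subnn add0n muln1 mulnC exp_XsubC_comp.
  by rewrite wt_comp_Xn // size_exp_XsubC.
rewrite rep_root_exponentS ?prime_gt0 // exprD [(p ^ g.+1)%N]expnS mulnCA.
apply: leq_trans (wtM _ _ _) _; apply: leq_mul => //.
rewrite exp_XsubC_comp wt_comp_Xn // size_exp_XsubC prednK //.
exact: prime_gt0.
Qed.

End RepeatedRoot.
End Weight.

(** * Pair distance, base ring and constacyclic ring *)

Section EvenOdd.
Variable R : comNzRingType.
Implicit Types q f g : {poly R}.

Lemma even_poly_comp_X2 f g : even_poly (f \Po 'X^2 + (g \Po 'X^2) * 'X) = f.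
Proof.
apply/polyP=> i; rewrite coef_even_poly coefD coefMX !coef_comp_poly_Xn //.
rewrite !dvdn2 odd_double divn2 doubleK.
by case: i => [|i]; rewrite ?doubleS /= ?odd_double addr0.
Qed.

Lemma odd_poly_comp_X2 f g : odd_poly (f \Po 'X^2 + (g \Po 'X^2) * 'X) = g.
Proof.
apply/polyP=> i; rewrite coef_odd_poly coefD coefMX !coef_comp_poly_Xn //=.
by rewrite !dvdn2 /= odd_double /= add0r divn2 doubleK.
Qed.

(** Turns divisibility of f by (X^2 - a0)^i into divisibility of both of its halves by (X -
    a0)^i. *)
Lemma even_odd_comp_X2M q f :
  (even_poly ((q \Po 'X^2) * f) = q * even_poly f) *
  (odd_poly ((q \Po 'X^2) * f) = q * odd_poly f).
Proof.
have -> : (q \Po 'X^2) * f = ((q * even_poly f) \Po 'X^2) +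
                             ((q * odd_poly f) \Po 'X^2) * 'X.
  by rewrite -{1}(poly_even_odd f) !rmorphM /= mulrDr mulrA.
by rewrite even_poly_comp_X2 odd_poly_comp_X2.
Qed.

End EvenOdd.

(** * Pair distance against the number of differing positions *)

Section PairDistance.
Variables (T : eqType) (n : nat) (x y : 'rV[T]_n) (A : {set 'I_n}).

(** For even n the cyclic successor changes parity, so A and its preimage under [ordS] are disjoint;
    every index in either one is counted by [d_sp]. *)
Lemma d_sp_ge b : ~~ odd n ->
  (forall i : 'I_n, i \in A -> odd i = b /\ x ord0 i != y ord0 i) ->
  (2 * #|A| <= d_sp x y)%N.
Proof.
move=> n_even A_sub; have ordS_inj := @ordS_inj n.
have disj : [disjoint A & @ordS n @^-1: A].
  apply/pred0P=> i /=; apply/negP=> /andP[/A_sub[odd_i _]].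
  rewrite inE => /A_sub[]; rewrite /= odd_mod ?(negPf n_even) // oddS odd_i.
  by case: b {A_sub odd_i}.
rewrite mul2n -addnn -{2}(card_preimset A ordS_inj).
move: disj; rewrite -leq_card_setU => /eqP <-.
apply/subset_leq_card/subsetP=> i; rewrite !inE xpair_eqE negb_and.
by case/orP=> /A_sub[_ ->]; rewrite ?orbT.
Qed.

(** A differing position i affects only the pairs starting at i and at its predecessor. *)
Lemma d_sp_le :
  (forall i : 'I_n, x ord0 i != y ord0 i -> i \in A) -> (d_sp x y <= 2 * #|A|)%N.
Proof.
move=> A_sup; rewrite mul2n -addnn -{2}(card_preimset A (@ordS_inj n)).
apply: leq_trans (leq_card_setU _ _).
apply/subset_leq_card/subsetP=> i; rewrite !inE xpair_eqE negb_and.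
by case/orP=> /A_sup->; rewrite ?orbT.
Qed.

End PairDistance.

(** * Coordinates, socle and squares of the base ring *)

Section DualNumbers.
Variable R : comNzRingType.
Local Notation dual := {poly %/ ('X^2 : {poly R})}.

Lemma qX_sq : 'qX * 'qX = 0 :> dual.
Proof.
rewrite -in_qpolyM -expr2; apply/in_qpoly_X2_eq0/polyP=> i.
by rewrite coef_take_poly coef0 coefXn; case: i => [|[|i]].
Qed.

Lemma dual_decomp (r : dual) :
  r = qpolyC 'X^2 (r : {poly R})`_0 + qpolyC 'X^2 (r : {poly R})`_1 * 'qX.
Proof.
rewrite -!in_qpolyC_X2 -in_qpolyM -in_qpolyD; apply: val_inj.
rewrite [RHS]in_qpoly_X2; apply/polyP=> i; rewrite coef_take_poly.
rewrite coefD coefC coefCM coefX.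
have sr : (size (r : {poly R}) < 3)%N.
  by apply: leq_trans (size_mk_monic r) _; rewrite mk_monic_Xn size_polyXn.
case: i => [|[|i]] /=; rewrite ?mulr0 ?addr0 ?mulr1 ?add0r //.
by rewrite nth_default // (leq_trans (ltnSE sr)).
Qed.

Lemma qpolyC_mul_qX_inj (x : R) : qpolyC 'X^2 x * 'qX = 0 :> dual -> x = 0.
Proof.
rewrite -in_qpolyC_X2 -in_qpolyM => /in_qpoly_X2_eq0/polyP/(_ 1).
by rewrite coef_take_poly coefCM coefX coef0 mulr1.
Qed.

End DualNumbers.

Section BaseRing.
Variable F : fieldType.
Local Notation u := (bu F).
Local Notation v := (bv F).

HB.instance Definition _ :=
  GRing.RMorphism.copy (@baseC F) (qpolyC ('X^2 : {poly dualR F}) \o qpolyC 'X^2).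

Lemma bu_sq : u * u = 0.
Proof. by rewrite /bu -qpolyCM qX_sq qpolyC0. Qed.

Lemma bv_sq : v * v = 0.
Proof. exact: qX_sq. Qed.

(* The coefficient of u^i v^j. *)
Definition cf (i j : nat) (r : baseR F) : F :=
  ((r : {poly dualR F})`_j : {poly F})`_i.

Lemma baseR_decomp (r : baseR F) :
  r = baseC (cf 0 0 r) + baseC (cf 1 0 r) * u
      + (baseC (cf 0 1 r) + baseC (cf 1 1 r) * u) * v.
Proof.
rewrite {1}(dual_decomp r) [X in qpolyC _ X + _]dual_decomp.
by rewrite [X in _ + qpolyC _ X * _]dual_decomp !(qpolyCD, qpolyCM).
Qed.

Lemma baseC_uv_eq0 (x : F) : baseC x * (u * v) = 0 -> x = 0.
Proof.
rewrite mulrA -qpolyCM => /qpolyC_mul_qX_inj; exact: qpolyC_mul_qX_inj.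
Qed.

Definition map_cf (i j : nat) (c : {poly baseR F}) : {poly F} :=
  \poly_(k < size c) cf i j c`_k.

Lemma coef_map_cf i j c k : (map_cf i j c)`_k = cf i j c`_k.
Proof.
rewrite coef_poly; case: ltnP => // le_k.
by rewrite nth_default // /cf coef0 /= coef0.
Qed.

(* The socle of F[u,v]/<u^2,v^2> is the line spanned by uv. *)
Lemma socle_multiple (c : {poly baseR F}) : c != 0 ->
  exists r (f : {poly F}), [/\ f != 0, (size f <= size c)%N &
    r *: c = (u * v) *: map_poly (@baseC F) f].
Proof.
have [u2 v2] := (bu_sq, bv_sq) => c0.
have mult i j r : map_cf i j c != 0 ->
    (forall k, r * c`_k = u * v * baseC (cf i j c`_k)) ->
  exists r (f : {poly F}), [/\ f != 0, (size f <= size c)%N &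
    r *: c = (u * v) *: map_poly (@baseC F) f].
  move=> cij0 rc; exists r, (map_cf i j c); split=> //; first exact: size_poly.
  by apply/polyP=> k; rewrite !coefZ coef_map coef_map_cf rc.
have cf0 i j : map_cf i j c = 0 -> forall k, cf i j c`_k = 0.
  by move=> c_ij k; rewrite -coef_map_cf c_ij coef0.
(* The coordinates along 1, u, v, uv are tried in this order; the first that is not identically zero
   is moved to uv by the multiplier uv, v, u or 1. *)
have [/cf0 c00 | c00] := eqVneq (map_cf 0 0 c) 0; last first.
  apply: (mult 0 0 (u * v)) => // k; rewrite [X in _ * X]baseR_decomp.
  have uv_mul x0 x1 x2 x3 : u * v * (x0 + x1 * u + (x2 + x3 * u) * v) =
     u * v * x0 + u * u * v * x1 + v * v * u * (x2 + x3 * u) by ring.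
  by rewrite uv_mul u2 v2; ring.
have [/cf0 c10 | c10] := eqVneq (map_cf 1 0 c) 0; last first.
  apply: (mult 1 0 v)%N => // k; rewrite [X in _ * X]baseR_decomp c00 rmorph0.
  have v_mul x1 x2 x3 : v * (0 + x1 * u + (x2 + x3 * u) * v) =
     u * v * x1 + v * v * (x2 + x3 * u) by ring.
  by rewrite v_mul v2; ring.
have [/cf0 c01 | c01] := eqVneq (map_cf 0 1 c) 0; last first.
  apply: (mult 0 1 u)%N => // k; rewrite [X in _ * X]baseR_decomp c00 c10 rmorph0.
  have u_mul x2 x3 : u * (0 + 0 * u + (x2 + x3 * u) * v) =
     u * v * x2 + u * u * v * x3 by ring.
  by rewrite u_mul u2; ring.
apply: (mult 1%N 1%N 1) => [|k].
  apply: contraNneq c0 => /cf0 c11; apply/eqP/polyP=> k.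
  by rewrite coef0 [LHS]baseR_decomp c00 c10 c01 c11 rmorph0; ring.
by rewrite [X in _ * X]baseR_decomp c00 c10 c01 rmorph0; ring.
Qed.

End BaseRing.

(** The root is found coordinate by coordinate, dividing by 2b; [c4] is first corrected by the cross
    term 2 c2 c3. Contrapositively, a nonsquare alpha forces a nonsquare a0. *)
Lemma is_square_baseR (F : fieldType) (b a2 a3 a4 : F) :
  b != 0 -> 2%:R != 0 :> F ->
  is_square (baseC (b ^+ 2) + baseC a2 * bu F + baseC a3 * bv F
             + baseC a4 * bu F * bv F).
Proof.
move=> b0 two0; pose d := (2%:R * b)^-1; pose c2 := a2 * d; pose c3 := a3 * d.
pose c4 := (a4 - 2%:R * c2 * c3) * d.
have d_half (c : F) : 2%:R * b * (c * d) = c.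
  by rewrite mulrCA mulfV ?mulr1 // mulf_neq0.
exists (baseC b + baseC c2 * bu F + baseC c3 * bv F + baseC c4 * (bu F * bv F)).
have e2 : a2 = 2%:R * b * c2 by rewrite d_half.
have e3 : a3 = 2%:R * b * c3 by rewrite d_half.
have e4 : a4 = 2%:R * b * c4 + 2%:R * c2 * c3 by rewrite d_half subrK.
rewrite e2 e3 e4; move: c2 c3 c4 {d_half e2 e3 e4} => c2 c3 c4.
rewrite !(rmorphD, rmorphM, rmorphXn, rmorph_nat) /=.
have := bu_sq F; have := bv_sq F.
move: (baseC b) (baseC c2) (baseC c3) (baseC c4) (bu F) (bv F).
move=> B C2 C3 C4 u v v2 u2.
have -> : (B + C2 * u + C3 * v + C4 * (u * v)) ^+ 2 =
  B ^+ 2 + 2%:R * B * C2 * u + 2%:R * B * C3 * v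
  + (2%:R * B * C4 + 2%:R * C2 * C3) * u * v
  + u * u * (C2 ^+ 2 + 2%:R * C2 * C4 * v)
  + v * v * (C3 ^+ 2 + 2%:R * C3 * C4 * u + C4 ^+ 2 * (u * u)) by ring.
by rewrite u2 v2 !mul0r !addr0.
Qed.

Lemma irreducible_X2_subC (F : fieldType) (a : F) :
  (forall b, a != b ^+ 2) -> irreducible_poly ('X^2 - a%:P).
Proof.
move=> nsq; apply: cubic_irreducible => [|b]; first by rewrite size_XnsubC.
by rewrite rootE !hornerE subr_eq0 eq_sym.
Qed.

Lemma irreducible_factor_exp (F : fieldType) (q f : {poly F}) :
  irreducible_poly q -> f != 0 ->
  exists k h, f = q ^+ k * h /\ coprimep q h.
Proof.
move=> q_irr f0; have [sq _] := q_irr.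
have bound k : q ^+ k %| f -> (k <= size f)%N.
  move=> /dvdp_leq -/(_ f0) le_f; apply: leq_trans le_f.
  have le_k : (k <= (size (q ^+ k)).-1)%N.
    by rewrite size_exp leq_pmull // ltn_predRL.
  exact: leq_trans le_k (leq_pred _).
have ex0 : exists k, q ^+ k %| f by exists 0; rewrite expr0 dvd1p.
have [k /dvdpP[h def_f] max_k] := ex_maxnP ex0 bound.
exists k, h; rewrite mulrC; split=> //.
rewrite irreducible_poly_coprime //; apply/negP=> /dvdpP[h' def_h].
have := max_k k.+1; rewrite ltnn def_f def_h -mulrA -exprS dvdp_mull //.
by move/(_ isT).
Qed.

(** * The constacyclic ring as a target of F[X] *)

Section ConstacyclicRing.
Variables (F : fieldType) (n : nat) (alpha : baseR F).
Hypothesis n_gt0 : (0 < n)%N.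
Local Notation A := (ccring n alpha).

(** Being a ring morphism, it carries Frobenius and Bezout identities of F[X] over to the
    quotient. *)
Definition poly_cc : {poly F} -> A :=
  in_qpoly (ccmod n alpha) \o map_poly (@baseC F).

HB.instance Definition _ := GRing.RMorphism.copy poly_cc
  (in_qpoly (ccmod n alpha) \o map_poly (@baseC F)).

Lemma ccCM (x y : baseR F) : ccC n alpha (x * y) = ccC n alpha x * ccC n alpha y.
Proof. exact: qpolyCM. Qed.

Lemma size_cc (c : A) : (size (c : {poly baseR F}) <= n)%N.
Proof.
rewrite -ltnS; apply: leq_trans (size_mk_monic c) _.
by rewrite mk_monic_ccmod // size_XnsubC.
Qed.

Lemma in_qpoly_id (c : A) : in_qpoly (ccmod n alpha) c = c.
Proof. by apply: val_inj; rewrite [LHS]in_qpoly_small // size_mk_monic. Qed.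

Lemma ccC_scale r (c : A) : ccC n alpha r * c = r *: c.
Proof.
have -> : ccC n alpha r = r *: (1 : A) by apply: val_inj; rewrite /= alg_polyC.
by rewrite -scalerAl mul1r.
Qed.

Lemma coef_ccC_mul r (c : A) i :
  ((ccC n alpha r * c : A) : {poly baseR F})`_i = r * (c : {poly baseR F})`_i.
Proof. by rewrite ccC_scale /= coefZ. Qed.

Lemma coef_poly_cc (f : {poly F}) i : (size f <= n)%N ->
  (poly_cc f : {poly baseR F})`_i = baseC f`_i.
Proof.
move=> sf; have -> : (poly_cc f : {poly baseR F}) = map_poly (@baseC F) f.
  rewrite [LHS]in_qpoly_small // mk_monic_ccmod // size_XnsubC // ltnS.
  exact: leq_trans (size_poly _ _) sf.
by rewrite coef_map.
Qed.

Lemma poly_ccX : poly_cc 'X = ccX n alpha.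
Proof. by rewrite /poly_cc /= map_polyX. Qed.

Lemma poly_ccC b : poly_cc b%:P = ccF n alpha b.
Proof.
rewrite /poly_cc /= map_polyC; apply: val_inj; rewrite [LHS]in_qpoly_small //.
by apply: leq_ltn_trans (size_polyC_leq1 _) (size_mk_monic_gt1 _).
Qed.

Lemma ccX_exp_n : ccX n alpha ^+ n = ccC n alpha alpha.
Proof.
have -> : ccC n alpha alpha = in_qpoly (ccmod n alpha) alpha%:P.
  apply: val_inj; rewrite [RHS]in_qpoly_small //.
  by apply: leq_ltn_trans (size_polyC_leq1 _) (size_mk_monic_gt1 _).
rewrite /ccX -rmorphXn /=; apply/eqP; rewrite -subr_eq0 -rmorphB /=.
apply/eqP/val_inj; rewrite /= mk_monic_ccmod //.
exact: Pdiv.RingMonic.rmodpp (monicXnsubC _ n_gt0).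
Qed.

Lemma ccw_poly_cc a0 : ccw n alpha a0 = poly_cc ('X^2 - a0%:P).
Proof. by rewrite rmorphB rmorphXn /= poly_ccX poly_ccC. Qed.

(** Scaling a reduced representative by a constant needs no reduction, so [socle_multiple] passes to
    the quotient. *)
Lemma cc_socle_multiple (c : A) : c != 0 ->
  exists r (f : {poly F}), [/\ f != 0, (size f <= n)%N &
    ccC n alpha r * c = ccC n alpha (bu F * bv F) * poly_cc f].
Proof.
move=> c0; have [|r [f [f0 sf rc]]] := @socle_multiple F (c : {poly baseR F}).
  by apply: contra c0 => /eqP c0; apply/eqP/val_inj.
exists r, f; split=> //; first exact: leq_trans sf (size_cc c).
by rewrite !ccC_scale -{1}(in_qpoly_id c) -!in_qpolyZ rc.
Qed.

End ConstacyclicRing.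

(** * The symbol-pair distance of an ideal *)

Section Code.
Variables (p s : nat) (F : fieldType) (a0 a1 a2 a3 a4 : F).
Variable alpha : baseR F.
Hypotheses (p_prime : prime p) (pcharF : p \in [pchar F]).
Hypothesis alphaE : alpha = baseC a1 + baseC a2 * bu F + baseC a3 * bv F
                            + baseC a4 * bu F * bv F.
Hypotheses (a3_neq0 : a3 != 0) (a0E : a0 ^+ (p ^ s) = a1).
Hypothesis W_irr : irreducible_poly ('X^2 - a0%:P).
Local Notation n := (2 * p ^ s)%N.
Local Notation A := (ccring n alpha).
Local Notation w := (ccw n alpha a0).
Local Notation u := (ccu n alpha).
Local Notation uv := (ccC n alpha (bu F * bv F)).
Local Notation embed := (poly_cc n alpha).

Let q_gt0 : (0 < p ^ s)%N. Proof. by rewrite expn_gt0 prime_gt0. Qed.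
Let n_gt0 : (0 < n)%N. Proof. by rewrite muln_gt0. Qed.

(** Frobenius turns w^(p^s) into x^n - a0^(p^s), and x^n = alpha in the quotient. *)
Lemma ccw_exp : w ^+ (p ^ s) = ccC n alpha (alpha - baseC a1).
Proof.
rewrite ccw_poly_cc -rmorphXn exprB_pchar ?pchar_poly // -exprM.
rewrite -polyC_exp a0E rmorphB rmorphXn /= poly_ccX poly_ccC ccX_exp_n //.
by rewrite /ccC rmorphB.
Qed.

Lemma ccu_ccw_exp k :
  u * w ^+ (p ^ s + k) = ccC n alpha (baseC a3) * (uv * w ^+ k).
Proof.
suff u_nilp : u * ccC n alpha (alpha - baseC a1) = ccC n alpha (baseC a3) * uv.
  by rewrite exprD ccw_exp [LHS]mulrA u_nilp -mulrA.
rewrite /ccu -!ccCM alphaE; congr (ccC n _ _).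
have -> : bu F * (baseC a1 + baseC a2 * bu F + baseC a3 * bv F
    + baseC a4 * bu F * bv F - baseC a1) = baseC a3 * (bu F * bv F)
    + bu F * bu F * (baseC a2 + baseC a4 * bv F) by ring.
by rewrite bu_sq mul0r addr0.
Qed.

(** alpha - a1 lies in the ideal generated by u and v, which uv annihilates. *)
Lemma uv_ccw_exp : uv * w ^+ (p ^ s) = 0.
Proof.
rewrite ccw_exp -ccCM alphaE.
have -> : bu F * bv F * (baseC a1 + baseC a2 * bu F + baseC a3 * bv F
    + baseC a4 * bu F * bv F - baseC a1) =
    bu F * bu F * (baseC a2 * bv F) + bv F * bv F * (baseC a3 * bu F)
    + bu F * bu F * (bv F * bv F * baseC a4) by ring.
by rewrite bu_sq bv_sq !mul0r !addr0 /ccC qpolyC0.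
Qed.

Variables (g : A) (J : nat).
Local Notation I := (in_principal g).
Hypothesis J_least : is_least (fun j => I (u * w ^+ j)) J.

Lemma in_principalB c d : I c -> I d -> I (c - d).
Proof. by move=> [b ->] [b' ->]; exists (b - b'); rewrite mulrBl. Qed.

Lemma in_principalM b c : I c -> I (b * c).
Proof. by move=> [b' ->]; exists (b * b'); rewrite mulrA. Qed.

(** uv w^k and u w^(p^s+k) differ by the unit a3, so minimality of J decides membership. *)
Lemma uv_ccw_mem k : I (uv * w ^+ k) <-> (J <= p ^ s + k)%N.
Proof.
have [IJ J_min] := J_least; split=> [Ik | le_J].
  by apply: J_min; rewrite ccu_ccw_exp; apply: in_principalM.
have <- : ccC n alpha (baseC a3^-1) * (u * w ^+ (p ^ s + k)) = uv * w ^+ k.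
  rewrite ccu_ccw_exp mulrA -ccCM -rmorphM mulVf // rmorph1.
  by rewrite (_ : ccC n alpha 1 = 1) // mul1r.
have -> : u * w ^+ (p ^ s + k) = w ^+ (p ^ s + k - J) * (u * w ^+ J).
  by rewrite mulrCA -exprD subnK.
by do 2!apply: in_principalM.
Qed.

(** Write f = W^k h with W = X^2 - a0 and h prime to W. Modulo W^(p^s), which uv kills, h is
    invertible; hence uv w^k is in the ideal and J <= p^s + k. For J <= p^s the truncated exponent
    is 0. *)
Lemma uv_mem_dvd (f : {poly F}) : f != 0 -> (size f <= n)%N ->
  I (uv * embed f) -> ('X^2 - a0%:P) ^+ (J - p ^ s) %| f.
Proof.
move=> f0 sf; have [k [h [def_f cop_h]]] := irreducible_factor_exp W_irr f0.
rewrite def_f => I_f; apply/dvdp_mulr/dvdp_exp2l.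
suff /uv_ccw_mem : I (uv * w ^+ k) by lia.
have /Bezout_eq1_coprimepP[[b c] /= bez] := coprimep_expl (p ^ s) cop_h.
have -> : uv * w ^+ k = embed c * (uv * embed (('X^2 - a0%:P) ^+ k * h)).
  have /(congr1 embed) := bez.
  rewrite rmorphD !rmorphM !rmorphXn rmorph1 /= -ccw_poly_cc => bez_cc.
  rewrite -[LHS]mulr1 -bez_cc.
  have -> : forall B C H W K V : A, V * K * (B * W + C * H) =
     B * K * (V * W) + C * (V * (K * H)) by move=> *; ring.
  by rewrite uv_ccw_exp mulr0 add0r.
exact: in_principalM.
Qed.

Lemma d_sp_code_ge m x y :
  (forall f : {poly F}, f != 0 -> (size f <= p ^ s)%N ->
     ('X - a0%:P) ^+ (J - p ^ s) %| f -> (m <= wt (p ^ s) f)%N) ->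
  code_of I x -> code_of I y -> x <> y -> (2 * m <= d_sp x y)%N.
Proof.
move=> wt_ge [c Ic ->] [d Id ->] neq_cd.
have cd0 : c - d != 0 by rewrite subr_eq0; apply: contra_notN neq_cd => /eqP->.
have [r [f [f0 sf rcd]]] := cc_socle_multiple n_gt0 cd0.
(* r (c - d) = uv f and uv is injective on F, so the support of f only meets positions where c and d
   differ. *)
have coef_neq (i : 'I_n) : f`_i != 0 -> ccvec c ord0 i != ccvec d ord0 i.
  rewrite !mxE; apply: contra => /eqP eq_cd; apply/eqP/(@baseC_uv_eq0 F).
  rewrite mulrC -(coef_poly_cc alpha n_gt0) // -coef_ccC_mul -rcd coef_ccC_mul.
  by rewrite coefB eq_cd subrr mulr0.
have dvd_f : ('X^2 - a0%:P) ^+ (J - p ^ s) %| f.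
  by apply: uv_mem_dvd => //; rewrite -rcd; apply/in_principalM/in_principalB.
(* h is a nonzero half of f, odd when [b] is true; all its positions in f share the parity [b], as
   [d_sp_ge] requires. *)
have [b [h [h0 sh dvd_h coef_h]]] : exists (b : bool) (h : {poly F}),
  [/\ h != 0, (size h <= p ^ s)%N, ('X - a0%:P) ^+ (J - p ^ s) %| h &
      forall j, h`_j = f`_(b + j.*2)].
  have [f' def_f] := dvdpP _ _ dvd_f.
  have {}def_f : f = (('X - a0%:P) ^+ (J - p ^ s) \Po 'X^2) * f'.
    by rewrite def_f mulrC rmorphXn /= comp_polyB comp_polyX comp_polyC.
  have [fe0 | fe0] := eqVneq (even_poly f) 0.
    exists true, (odd_poly f); split.
    - apply: contraNneq f0 => fo0.
      by rewrite -(poly_even_odd f) fe0 fo0 !comp_poly0 mul0r addr0.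
    - apply: leq_trans (size_odd_poly f) _; lia.
    - by rewrite def_f even_odd_comp_X2M dvdp_mulr.
    - by move=> j; rewrite coef_odd_poly.
  exists false, (even_poly f); split=> //.
  - apply: leq_trans (size_even_poly f) _; lia.
  - by rewrite def_f even_odd_comp_X2M dvdp_mulr.
  - by move=> j; rewrite coef_even_poly.
apply: leq_trans (_ : 2 * wt (p ^ s) h <= _)%N; first by rewrite leq_mul2l wt_ge.
have lt_pos (j : 'I_(p ^ s)) : (b + j.*2 < n)%N.
  rewrite mul2n; apply: (leq_trans (n := j.+1.*2)); last by rewrite leq_double.
  by rewrite doubleS -addSn -add2n leq_add2r; case: (b).
pose pos j := Ordinal (lt_pos j).
have pos_inj : injective pos.
  by move=> i j /(congr1 val) /= /addnI/double_inj/val_inj.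
rewrite /wt -(card_imset _ pos_inj).
apply: (@d_sp_ge _ _ _ _ _ b); first by rewrite mul2n odd_double.
move=> _ /imsetP[j hj ->]; split.
  by rewrite /= oddD odd_double addbF; case: (b).
by apply: coef_neq; rewrite /= -coef_h; move: hj; rewrite inE.
Qed.

(** The two words are uv f(x^2) and 0; they differ only at the doubles of the positions in the
    support of f. *)
Lemma d_sp_code_le (f : {poly F}) : f != 0 -> (size f <= p ^ s)%N ->
    I (uv * embed (f \Po 'X^2)) ->
  exists x y, [/\ code_of I x, code_of I y, x <> y &
                  (d_sp x y <= 2 * wt (p ^ s) f)%N].
Proof.
move=> f0 sf If; pose c := uv * embed (f \Po 'X^2).
have sf2 : (size (f \Po 'X^2) <= n)%N.
  rewrite (leq_trans (size_comp_poly_leq _ _)) // size_polyXn /=.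
  have : (0 < size f)%N by rewrite size_poly_gt0.
  by move: sf; move: (size f) (p ^ s)%N => d N; lia.
have coef_c (i : 'I_n) : ccvec c ord0 i = bu F * bv F * baseC (f \Po 'X^2)`_i.
  by rewrite mxE coef_ccC_mul coef_poly_cc.
have I0 : I 0 by exists 0; rewrite mul0r.
exists (ccvec c), (ccvec (0 : A)); split; [by exists c | by exists 0 | |].
  have [j] := supp_neq0 f0 sf; rewrite inE => fj.
  have lt_j : (j * 2 < n)%N by rewrite mulnC ltn_pmul2l.
  move=> /rowP/(_ (Ordinal lt_j)); rewrite coef_c mxE coef0 mulrC.
  move/baseC_uv_eq0/eqP; rewrite coef_comp_poly_Xn // dvdn_mull // mulnK //.
  by rewrite (negPf fj).
have lt_pos (j : 'I_(p ^ s)) : (2 * j < n)%N by rewrite ltn_pmul2l.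
pose E := [set Ordinal (lt_pos j) | j in supp (p ^ s) f].
apply: (leq_trans (n := 2 * #|E|)); last by rewrite leq_mul2l leq_imset_card.
apply: d_sp_le => i; rewrite coef_c !mxE coef0.
rewrite coef_comp_poly_Xn //; case: ifP => [even_i | _]; last first.
  by rewrite rmorph0 mulr0 eqxx.
move=> fi; have lt_i : (i %/ 2 < p ^ s)%N.
  by rewrite ltn_divLR // muln2 -mul2n.
apply/imsetP; exists (Ordinal lt_i); last first.
  by apply: val_inj; rewrite /= [RHS]mulnC divnK.
by rewrite inE /=; apply: contraNneq fi => ->; rewrite rmorph0 mulr0.
Qed.

Lemma sp_distance_code m (f : {poly F}) : f != 0 -> (size f <= p ^ s)%N ->
    I (uv * embed (f \Po 'X^2)) -> (wt (p ^ s) f <= m)%N ->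
  (forall h : {poly F}, h != 0 -> (size h <= p ^ s)%N ->
     ('X - a0%:P) ^+ (J - p ^ s) %| h -> (m <= wt (p ^ s) h)%N) ->
  is_sp_distance (code_of I) (2 * m).
Proof.
move=> f0 sf If wt_f wt_ge; split; last by move=> x y; apply: d_sp_code_ge.
have [x [y [Ix Iy neq_xy le_xy]]] := d_sp_code_le f0 sf If.
exists x, y; split=> //; apply/eqP; rewrite eqn_leq d_sp_code_ge // andbT.
by rewrite (leq_trans le_xy) // leq_mul2l.
Qed.

(** Here uv itself is a codeword, so f = 1 attains weight 1. *)
Lemma sp_distance_small : (J <= p ^ s)%N -> is_sp_distance (code_of I) 2.
Proof.
move=> le_J; apply: (@sp_distance_code 1 1); rewrite ?oner_eq0 ?size_poly1 //.
- rewrite comp_polyC rmorph1; have /uv_ccw_mem := leq_trans le_J (leq_addr 0 _).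
  by rewrite expr0.
- by rewrite -[X in wt _ X](comp_polyC 1 'X^1) wt_comp_Xn // size_poly1.
- by move=> h h0 sh _; apply: wt_gt0.
Qed.

Lemma sp_distance_band k g' e : s = (g' + e).+1 -> (k.+1 < p)%N -> a0 != 0 ->
    (p ^ s + (p ^ s - p ^ e.+1 + k * p ^ e) < J
     <= p ^ s + (p ^ s - p ^ e.+1 + k.+1 * p ^ e))%N ->
  is_sp_distance (code_of I) (2 * (k.+2 * p ^ g')).
Proof.
move=> def_s lt_kp a00 /andP[lt_J le_J].
(* The upper end of the band: (X - a0)^i has low weight and uv w^i is in the ideal because J <= p^s
   + i. Its degree is below p^s since k + 2 <= p. *)
pose i := (p ^ s - p ^ e.+1 + k.+1 * p ^ e)%N.
apply: (sp_distance_code (f := ('X - a0%:P) ^+ i)).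
- by rewrite expf_neq0 // polyXsubC_eq0.
- rewrite size_exp_XsubC /i.
  have : (k.+2 * p ^ e <= p ^ e.+1)%N by rewrite expnS leq_mul2r lt_kp orbT.
  have : (p ^ e.+1 <= p ^ s)%N.
    by rewrite leq_pexp2l ?prime_gt0 // def_s ltnS leq_addl.
  have : (0 < p ^ e)%N by rewrite expn_gt0 prime_gt0.
  rewrite [(k.+2 * _)%N]mulSn; lia.
- have -> : embed (('X - a0%:P) ^+ i \Po 'X^2) = w ^+ i.
    rewrite ccw_poly_cc -rmorphXn; congr (embed _).
    by rewrite [LHS]rmorphXn /= comp_polyB comp_polyX comp_polyC.
  exact/uv_ccw_mem.
- by rewrite /i def_s rep_root_wt_le.
- move=> h h0 sh dvd_h; rewrite def_s; apply: rep_root_wt_ge (a0) _ _ _ _ _ => //.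
    by rewrite -def_s.
  (* J - p^s is at least the lower end of the band plus one, the exponent in [rep_root_wt_ge]. *)
  apply: dvdp_trans dvd_h; apply: dvdp_exp2l; rewrite -def_s; lia.
Qed.

End Code.

(** * Irreducibility of x^2 - a0, range of J and translation of the bands *)

Theorem theorem5p3
  (p m s : nat) (F : finFieldType)
  (p_prime : prime p) (p_odd : odd p) (m_gt0 : (0 < m)%N) (s_gt0 : (0 < s)%N)
  (cardF : #|F| = (p ^ m)%N)
  (a1 a2 a3 a4 : F) (a1_neq0 : a1 != 0) (a2_neq0 : a2 != 0) (a3_neq0 : a3 != 0)
  (alpha : baseR F)
  (alphaE : alpha = baseC a1 + baseC a2 * bu F + baseC a3 * bv F
                    + baseC a4 * bu F * bv F)
  (alpha_nonsquare : ~ is_square alpha)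
  (a0 : F) (a0E : a0 ^+ (p ^ s) = a1)
  (l t : nat) (l_le : (l <= 2 * p ^ s - 1)%N) (t_lt : (t < l)%N)
  (z : ccring (2 * p ^ s) alpha) (z_form : zero_or_unit_form a0 z) :
  let n := (2 * p ^ s)%N in
  let w := ccw n alpha a0 in
  let u := ccu n alpha in
  let C := in_principal (w ^+ l + u * w ^+ t * z) in
  forall (J : nat) (J_least : is_least (fun j => C (u * w ^+ j)) J),
  [/\ (J <= p ^ s)%N \/
      (exists G g : nat,
         [/\ (1 <= G <= p - 1)%N, (g <= s - 1)%N &
             (2 * p ^ s - p ^ (s - g) + (G - 1) * p ^ (s - g - 1) + 1 <= J
              <= 2 * p ^ s - p ^ (s - g) + G * p ^ (s - g - 1))%N]),
      (J <= p ^ s)%N -> is_sp_distance (code_of C) 2 &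
      forall G g : nat,
        (1 <= G <= p - 1)%N -> (g <= s - 1)%N ->
        (2 * p ^ s - p ^ (s - g) + (G - 1) * p ^ (s - g - 1) + 1 <= J
         <= 2 * p ^ s - p ^ (s - g) + G * p ^ (s - g - 1))%N ->
        is_sp_distance (code_of C) (2 * (G + 1) * p ^ g)].
Proof.
move=> n w u C J J_least.
have pcharF : p \in [pchar F] by apply: card_finPcharP cardF p_prime.
have p_gt0 := prime_gt0 p_prime.
have a0_neq0 : a0 != 0.
  apply: contraNneq a1_neq0 => a0_0.
  by rewrite -a0E a0_0 expr0n expn_eq0 eqn0Ngt p_gt0.
(* If a0 = b^2, then a1 = (b^(p^s))^2 is a nonzero square and alpha would be a square, 2 being
   invertible for odd p. *)
have W_irr : irreducible_poly ('X^2 - a0%:P).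
  apply: irreducible_X2_subC => b.
  apply: contra_notN alpha_nonsquare => /eqP a0_sq.
  rewrite alphaE -a0E a0_sq exprAC; apply: is_square_baseR.
    rewrite expf_neq0 //; apply: contraNneq a0_neq0 => b0.
    by rewrite a0_sq b0 expr0n.
  rewrite -(dvdn_pcharf pcharF) dvdn_prime2 //.
  by apply: contraTneq p_odd => ->.
have pow_le e : (e <= s)%N -> (p ^ e <= p ^ s)%N by move=> ?; rewrite leq_pexp2l.
have double_pow : (2 * p ^ s = p ^ s + p ^ s)%N by rewrite mul2n addnn.
split.
(* u times the generator is u w^l, so J <= l < 2p^s and J - p^s is in the range of
   [rep_root_band]. *)
- have u_sq : u * u = 0 by rewrite /u /ccu -ccCM bu_sq /ccC qpolyC0.
  have le_Jl : (J <= l)%N.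
    have [_ J_min] := J_least; apply: J_min; exists u.
    by rewrite mulrDr !mulrA u_sq !mul0r addr0.
  have [le_J | lt_J] := leqP J (p ^ s); [by left | right].
  have [|g [e [k [def_s lt_kp le_i]]]] := @rep_root_band p s (J - p ^ s) p_gt0.
    lia.
  (* Bands are numbered from k = 0 in [rep_root_band], so G = k + 1; also s - g = e + 1. *)
  exists k.+1, g; rewrite def_s in le_i *.
  rewrite [((g + e).+1 - g)%N](_ : _ = e.+1); last by lia.
  rewrite !subn1 /=.
  have := pow_le e.+1; rewrite def_s ltnS leq_addl => /(_ isT) le_e.
  split; [lia | exact: leq_addr | lia].
- exact: (sp_distance_small p_prime pcharF alphaE a3_neq0 a0E W_irr J_least).
move=> [|k] g; first by [].
rewrite !subn1 /= => lt_kp le_g le_J; pose e := (s - g).-1.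
have def_s : s = (g + e).+1 by rewrite /e; lia.
have def_e : (s - g = e.+1)%N by lia.
rewrite -mulnA addn1.
apply: (sp_distance_band p_prime pcharF alphaE a3_neq0 a0E W_irr J_least def_s);
  rewrite //; first by lia.
(* p^(e+1) <= p^s allows regrouping the truncated 2p^s - p^(e+1) as p^s + (p^s - p^(e+1)). *)
have le_e := pow_le e.+1; rewrite def_e /= in le_J.
lia.
Qed.
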